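(* Let $\sigma$ be a relational signature. Identify $\mathrm{Fin}(\sigma)$ with its image in $\mathcal{M}_{\Gamma}(\mathrm{FO}(\sigma))$ under $A\mapsto\langle\cdot,A\rangle_{\Gamma}$, and with its image in $\mathcal{M}_{I}(\mathrm{FO}(\sigma))$ under $A\mapsto\langle\cdot,A\rangle_{I}$. Let $\overline{\mathrm{Fin}(\sigma)}$ be the closure of $\mathrm{Fin}(\sigma)$ in $\mathcal{M}_{\Gamma}(\mathrm{FO}(\sigma))$. Then $\gamma^{\#}\big(\overline{\mathrm{Fin}(\sigma)}\big)$ coincides with the closure of $\mathrm{Fin}(\sigma)$ in $\mathcal{M}_{I}(\mathrm{FO}(\sigma))$.
   Context: The Priestley space $\mathbf{\Gamma}$. Its underlying set consists of formal symbols $\{r^{-}\mid r\in(0,1]\}\cup\{q^{\circ}\mid q\in[0,1]\cap\mathbb{Q}\}$, totally ordered by: $r^{-}<s^{-}$ iff $r<s$; $p^{\circ}<q^{\circ}$ iff $p<q$; $r^{-}<q^{\circ}$ iff $r\le q$; $q^{\circ}<r^{-}$ iff $q<r$. Its topology is generated by the sets $\{x\mid p^{\circ}\le x\}$ for $p\in\mathbb{Q}\cap[0,1]$ and $\{x\mid x\le q^{-}\}$ for $q\in\mathbb{Q}\cap(0,1]$. Two partial operations on $\mathbf{\Gamma}$, $x-y$ and $x\sim y$, are defined exactly when $y\le x$. The first is: $r^{\circ}-s^{\circ}=(r-s)^{\circ}$; $r^{-}-s^{\circ}=(r-s)^{-}$; and both $r^{\circ}-s^{-}$ and $r^{-}-s^{-}$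 equal $(r-s)^{\circ}$ if $r-s\in\mathbb{Q}$ and $(r-s)^{-}$ otherwise. The second is $x\sim y=\bigvee\{x-q^{\circ}\mid q\in\mathbb{Q}\cap[0,1],\ y<q^{\circ}\le x\}$. A partial addition $x+y$ is defined when $x\le1^{\circ}-y$, by $r^{\circ}+s^{\circ}=(r+s)^{\circ}$ and $r^{-}+s^{\circ}=r^{\circ}+s^{-}=r^{-}+s^{-}=(r+s)^{-}$; iterated sums are written $\sum$ (the empty sum is $0^\circ$). A $\mathbf{\Gamma}$-valued measure on a bounded distributive lattice $D$ is a function $\mu\colon D\to\mathbf{\Gamma}$ such that (1) $\mu$ is monotone; (2) $\mu(0)=0^{\circ}$ and $\mu(1)=1^{\circ}$; (3) for all $a,b\in D$, $\mu(a)\sim\mu(a\wedge b)\le\mu(a\vee b)-\mu(b)$ and $\mu(a)-\mu(a\wedge b)\ge\mu(a\vee b)\sim\mu(b)$. $\mathcal{M}_{\Gamma}(D)$ is the set of all such measures, with the topology induced by the product topology of $\mathbf{\Gamma}^{D}$. $\mathcal{M}_{I}(D)$ is the set of monotone functions $m\colon D\to[0,1]$ with $m(0)=0$, $m(1)=1$ and $m(a)+m(b)=m(a\vee b)+m(a\wedge b)$ for all $a,b\in D$, with the topology induced by the product topology of $[0,1]^{D}$. The map $\gamma\colon\mathbf{\Gamma}\to[0,1]$ sends $r^{-}$ and $r^{\circ}$ to $r$, and $\gamma^{\#}\colon\mathcal{M}_{\Gamma}(D)\to\mathcal{M}_{I}(D)$ is the well-defined map $\mu\mapsto\gamma\circ\mu$.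 Fix distinct variables $v_1,v_2,\dots$. $\mathrm{FO}_n(\sigma)$ is the Boolean algebra of first-order $\sigma$-formulas with free variables among $v_1,\dots,v_n$ modulo logical equivalence, and $\mathrm{FO}(\sigma)=\bigcup_n\mathrm{FO}_n(\sigma)$. $\mathrm{Fin}(\sigma)$ is the set of isomorphism classes of finite (non-empty) $\sigma$-structures. $\mathrm{Typ}_n(\sigma)$ is the set of classes, under elementary equivalence, of pairs $(B,\beta)$ with $B$ a $\sigma$-structure and $\beta\colon\{v_1,\dots,v_n\}\to B$ (two pairs being equivalent if they satisfy the same formulas of $\mathrm{FO}_n(\sigma)$); $[\![\varphi]\!]_n\subseteq\mathrm{Typ}_n(\sigma)$ is the set of classes of pairs satisfying $\varphi$. Classical Stone pairing: for $\varphi$ with free variables among $v_1,\dots,v_n$, $\langle\varphi,A\rangle_{I}=|\{\overline{a}\in A^n\mid A\models\varphi(\overline{a})\}|/|A|^n$. $\mathbf{\Gamma}$-valued Stone pairing: for $A\in\mathrm{Fin}(\sigma)$ and $E\in\mathrm{Typ}_n(\sigma)$ let $f_n^A(E)=\sum_{\alpha\colon\{v_1,\dots,v_n\}\to A,\ (A,\alpha)\in E}\left(1/|A|^n\right)^{\circ}$, which is $\neq0^{\circ}$ for only finitely many $E$. Let $\mu_n^A\colon\mathrm{FO}_n(\sigma)\to\mathbf{\Gamma}$, $\mu_n^A(\varphi)=\sum_{E\in[\![\varphi]\!]_n,\ f_n^A(E)\ne0^{\circ}}f_n^A(E)$. The $\mu_n^A$ are measures compatible under restriction, and $\langle\cdot,A\rangle_{\Gamma}\colon\mathrm{FO}(\sigma)\to\mathbf{\Gamma}$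 is the unique measure whose restriction to $\mathrm{FO}_n(\sigma)$ is $\mu_n^A$ for every $n$. *)

(* Defs.v *)
From HB Require Import structures.
From mathcomp Require Import all_boot all_order all_algebra generic_quotient.
From mathcomp Require Import all_classical all_reals all_analysis.
Set Implicit Arguments.
Unset Strict Implicit.
Unset Printing Implicit Defensive.
Import Order.TTheory GRing.Theory Num.Theory.
Import numFieldNormedType.Exports.
Local Open Scope classical_set_scope.
Local Open Scope ring_scope.
Local Open Scope quotient_scope.

Definition israt (R : realType) (r : R) : bool := `[< exists q : rat, r = ratr q >].

(* [Minus r] is r^- and [Circ q] is q°. Both carry a real number so that the
   arithmetic of symbols is uniform; the ranges r in (0, 1] and q in [0, 1],
   q rational, are imposed by [gvalid]. *)
Variant gsymb (R : realType) := Minus of R | Circ of R.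

HB.instance Definition _ (R : realType) := gen_eqMixin (gsymb R).
HB.instance Definition _ (R : realType) := gen_choiceMixin (gsymb R).

Definition gvalid (R : realType) (x : gsymb R) : bool :=
  match x with
  | Minus r => 0 < r <= 1
  | Circ q => (0 <= q <= 1) && israt q
  end.

Record Gamma (R : realType) := MkGamma { gval : gsymb R; _ : gvalid gval }.

HB.instance Definition _ (R : realType) := [isSub for @gval R].
HB.instance Definition _ (R : realType) := [Choice of Gamma R by <:].

Definition gsymb_lt (R : realType) (x y : gsymb R) : bool :=
  match x, y with
  | Minus r, Minus s => r < s
  | Circ p, Circ q => p < q
  | Minus r, Circ q => r <= q
  | Circ q, Minus r => q < r
  end.

Section GammaOrder.
Context {R : realType}.
Implicit Types x y z : Gamma R.

Definition glt x y := gsymb_lt (gval x) (gval y).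
Definition gle x y := (x == y) || glt x y.

Fact glt_irr x : glt x x = false.
Proof. by case: x => -[r|r] /= h; rewrite /glt /= ltxx. Qed.

Fact glt_trans : transitive glt.
Proof.
move=> [y hy] [x hx] [z hz]; rewrite /glt /= => {hx hy hz}.
case: x y z => [x|x] [y|y] [z|z] //= h1 h2.
- exact: lt_trans h1 h2.
- exact: le_trans (ltW h1) h2.
- exact: le_lt_trans h1 h2.
- exact: le_trans h1 (ltW h2).
- exact: lt_trans h1 h2.
- exact: lt_le_trans h1 h2.
- exact: lt_trans h1 h2.
- exact: lt_trans h1 h2.
Qed.

Fact glt_def x y : glt x y = (y != x) && gle x y.
Proof.
rewrite /gle [x == y]eq_sym.
by have [->|nxy] //= := eqVneq y x; rewrite glt_irr.
Qed.

Fact gle_anti : antisymmetric gle.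
Proof.
move=> x y /andP[/orP[/eqP //|xy] /orP[/eqP //|yx]].
by have := glt_trans xy yx; rewrite glt_irr.
Qed.

Fact gle_trans : transitive gle.
Proof.
move=> y x z /orP[/eqP -> //|xy] /orP[/eqP <-|yz]; rewrite /gle; first by rewrite xy orbT.
by rewrite (glt_trans xy yz) orbT.
Qed.

Fact gle_total : total gle.
Proof.
move=> x y; rewrite /gle [y == x]eq_sym.
have [//|] /= := eqVneq x y.
case: x y => [x hx] [y hy]; rewrite -val_eqE /= /glt /=.
case: x y {hx hy} => [x|x] [y|y] /=.
- by case: ltgtP => //= ->; rewrite eqxx.
- by case: leP.
- by rewrite orbC; case: leP.
- by case: ltgtP => //= ->; rewrite eqxx.
Qed.

End GammaOrder.

Fact gamma_display : Order.disp_t.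
Proof. by constructor. Qed.

HB.instance Definition _ (R : realType) :=
  Order.isOrder.Build gamma_display (Gamma R) glt_def
    (fun _ _ => erefl) (fun _ _ => erefl) gle_anti gle_trans gle_total.

Section GammaOps.
Context {R : realType}.
Implicit Types x y : Gamma R.

Fact circ0_valid : gvalid (Circ (0 : R)).
Proof. by rewrite /= lexx ler01 /=; apply/asboolP; exists 0; rewrite rmorph0. Qed.

Definition gzero : Gamma R := MkGamma circ0_valid.

(* The operations on Gamma are partial. They are made total by returning 0° when
   the resulting symbol is not in Gamma, which never happens on their domain of
   definition: see [gsub_valid] and [gadd_valid]. *)
Definition mkG (s : gsymb R) : Gamma R := insubd gzero s.

Definition circ (q : rat) : Gamma R := mkG (Circ (ratr q)).
Definition minus (r : R) : Gamma R := mkG (Minus r).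

Definition gsymb_sub (x y : gsymb R) : gsymb R :=
  match x, y with
  | Circ r, Circ s => Circ (r - s)
  | Minus r, Circ s => Minus (r - s)
  | Circ r, Minus s | Minus r, Minus s =>
      if israt (r - s) then Circ (r - s) else Minus (r - s)
  end.

Definition gsub x y : Gamma R := mkG (gsymb_sub (gval x) (gval y)).

(* [supremum] is the least upper bound in the total order of Gamma, which exists
   for every nonempty set by [gsupremums_neq0]; the empty join, which occurs for
   x = y, is the least element 0°. *)
Definition gsim x y : Gamma R :=
  supremum gzero [set gsub x (circ q) | q in
    [set q : rat | [/\ 0 <= q <= 1, (y < circ q)%O & (circ q <= x)%O]]].

Definition gsymb_add (x y : gsymb R) : gsymb R :=
  match x, y with
  | Circ r, Circ s => Circ (r + s)
  | Minus r, Circ s | Circ r, Minus s | Minus r, Minus s => Minus (r + s)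
  end.

Definition gadd x y : Gamma R := mkG (gsymb_add (gval x) (gval y)).

Definition gamma x : R := match gval x with Minus r => r | Circ r => r end.

Definition gamma_subbase : set (set (Gamma R)) :=
  [set U | (exists2 p : rat, 0 <= p <= 1 & U = [set x | (circ p <= x)%O]) \/
           (exists2 q : rat, 0 < q <= 1 & U = [set x | (x <= minus (ratr q))%O])].

End GammaOps.

HB.instance Definition _ (R : realType) :=
  isSubBaseTopological.Build (Gamma R) (@gamma_subbase R) id.

Section GammaTheory.
Context {R : realType}.
Implicit Types x y : Gamma R.

Lemma gval_mkG (s : gsymb R) : gvalid s -> gval (mkG s) = s.
Proof. by move=> h; rewrite /mkG (insubdK gzero). Qed.

Lemma israt_ratr q : israt (ratr q : R).
Proof. by apply/asboolP; exists q. Qed.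

Lemma isratB (r s : R) : israt r -> israt s -> israt (r - s).
Proof.
move=> /asboolP[p ->] /asboolP[q ->]; rewrite -rmorphB; exact: israt_ratr.
Qed.

Lemma isratD (r s : R) : israt r -> israt s -> israt (r + s).
Proof.
move=> /asboolP[p ->] /asboolP[q ->]; rewrite -rmorphD; exact: israt_ratr.
Qed.

Lemma circ_valid (q : rat) : 0 <= q <= 1 -> gvalid (Circ (ratr q : R)).
Proof.
by move=> /andP[q0 q1]; rewrite /= israt_ratr ler0q q0 -(rmorph1 ratr) ler_rat q1.
Qed.

Lemma gval_circ (q : rat) : 0 <= q <= 1 -> gval (circ q : Gamma R) = Circ (ratr q).
Proof. by move=> h; rewrite gval_mkG ?circ_valid. Qed.

Lemma gval_inj : injective (@gval R).
Proof. exact: val_inj. Qed.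

Lemma gltE x y : (x < y)%O = gsymb_lt (gval x) (gval y).
Proof. by []. Qed.

Lemma gleNlt x y : (x <= y)%O = ~~ gsymb_lt (gval y) (gval x).
Proof. by rewrite -gltE leNgt. Qed.

Lemma gsub_valid x y : (y <= x)%O -> gvalid (gsymb_sub (gval x) (gval y)).
Proof.
rewrite gleNlt; case: x y => [x hx] [y hy] /=.
case: x y hx hy => [x|x] [y|y] /=; rewrite -?leNgt -?ltNge.
- move=> /andP[x0 x1] /andP[y0 y1] yx.
  have h1 : x - y <= 1 by rewrite lerBlDr (le_trans x1) // lerDl ltW.
  case: ifPn => [hr|hr] /=; first by rewrite subr_ge0 yx h1.
  rewrite h1 andbT subr_gt0 lt_neqAle yx andbT.
  by apply: contra hr => /eqP ->; rewrite subrr -(rmorph0 ratr) israt_ratr.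
- move=> /andP[x0 x1] /andP[/andP[y0 y1] ry] yx.
  by rewrite subr_gt0 yx lerBlDr (le_trans x1) // lerDl.
- move=> /andP[/andP[x0 x1] rx] /andP[y0 y1] yx.
  have h1 : x - y <= 1 by rewrite lerBlDr (le_trans x1) // lerDl ltW.
  case: ifPn => [hr|hr] /=; first by rewrite subr_ge0 yx h1.
  rewrite h1 andbT subr_gt0 lt_neqAle yx andbT.
  by apply: contra hr => /eqP ->; rewrite subrr -(rmorph0 ratr) israt_ratr.
- move=> /andP[/andP[x0 x1] rx] /andP[/andP[y0 y1] ry] yx.
  by rewrite subr_ge0 yx isratB // lerBlDr (le_trans x1) // lerDl.
Qed.

Lemma circ0 : circ 0 = gzero :> Gamma R.
Proof. by apply/gval_inj; rewrite gval_circ //= rmorph0. Qed.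

Lemma gadd_valid x y :
  (x <= gsub (circ 1) y)%O -> gvalid (gsymb_add (gval x) (gval y)).
Proof.
rewrite gleNlt /gsub gval_circ // rmorph1.
have hy1 : (y <= circ 1)%O.
  rewrite gleNlt gval_circ // rmorph1; case: y => -[y|y] /= hy; rewrite -?leNgt -?ltNge.
    by case/andP: hy.
  by case/andP: hy => /andP[].
have := gsub_valid hy1; rewrite gval_circ // rmorph1 => hv.
rewrite gval_mkG //; case: x y hv {hy1} => [x hx] [y hy] /=.
case: x y hx hy => [x|x] [y|y] /=.
- move=> /andP[x0 x1] /andP[y0 y1]; case: ifPn => hr /= h; rewrite -?leNgt -?ltNge => h'.
  + by rewrite addr_gt0 //= -lerBrDr.
  + by rewrite addr_gt0 //= -lerBrDr.
- move=> /andP[x0 x1] /andP[/andP[y0 y1] ry] /= h; rewrite -?leNgt -?ltNge => h'.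
  by rewrite ltr_pwDl //= -lerBrDr.
- move=> /andP[/andP[x0 x1] rx] /andP[y0 y1]; case: ifPn => hr /= h; rewrite -?leNgt -?ltNge => h'.
  + by rewrite ltr_wpDl //= -lerBrDr.
  + by rewrite ltr_wpDl //= -lerBrDr ltW.
- move=> /andP[/andP[x0 x1] rx] /andP[/andP[y0 y1] ry] /= h; rewrite -?leNgt -?ltNge => h'.
  by rewrite addr_ge0 //= -lerBrDr h' isratD.
Qed.
End GammaTheory.

Section GammaSup.
Context {R : realType}.
Implicit Types (x y : Gamma R) (S : set (Gamma R)).

Lemma gamma_ge0 x : 0 <= gamma x.
Proof.
case: x => -[r|r]; rewrite /gamma /= => /andP[h _]; first exact: ltW.
by case/andP: h.
Qed.

Lemma gamma_le1 x : gamma x <= 1.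
Proof.
case: x => -[r|r]; rewrite /gamma /= => /andP[h h'] //.
by case/andP: h.
Qed.

Lemma gval_gamma_le0 x : gamma x <= 0 -> gval x = Circ 0.
Proof.
case: x => -[r|r]; rewrite /gamma /= => /andP[h1 _] h3.
  by move: (lt_le_trans h1 h3); rewrite ltxx.
by congr Circ; apply/eqP; rewrite eq_le h3; case/andP: h1.
Qed.

Lemma gamma_mono x y : (x <= y)%O -> gamma x <= gamma y.
Proof.
rewrite gleNlt; case: x y => [x hx] [y hy]; rewrite /gamma /=.
by case: x y {hx hy} => [x|x] [y|y] /=; rewrite -?leNgt -?ltNge // => /ltW.
Qed.

Lemma gamma_lt x y : gamma x < gamma y -> (x < y)%O.
Proof. by rewrite !ltNge; apply: contra => /gamma_mono. Qed.

Lemma gamma_circ (q : rat) : 0 <= q <= 1 -> gamma (circ q : Gamma R) = ratr q.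
Proof. by move=> h; rewrite /gamma gval_circ. Qed.

Lemma gamma_gsub x y : (y <= x)%O -> gamma (gsub x y) = gamma x - gamma y.
Proof.
move=> yx; rewrite /gamma /gsub gval_mkG ?gsub_valid //.
by case: (gval x) (gval y) => [r|r] [s|s] //=; case: ifP.
Qed.

Lemma gsupremums_neq0 S : S !=set0 -> supremums S !=set0.
Proof.
move=> S0; pose t := sup (gamma @` S).
have hs : has_sup (gamma @` S).
  split; first by case: S0 => x Sx; exists (gamma x), x.
  by exists 1 => _ [x _ <-]; exact: gamma_le1.
have tub x : S x -> gamma x <= t.
  by move=> Sx; apply: ub_le_sup; [case: hs | exists x].
have tlt x : gamma x < t -> exists2 y, S y & gamma x < gamma y.
  move=> xt; have d0 : 0 < t - gamma x by rewrite subr_gt0.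
  have [_ [y Sy <-] h] := sup_adherent d0 hs; exists y => //.
  by move: h; rewrite -/t opprB addrC subrK.
have [[z Sz zt]|nS] := pselect (exists2 z, S z & gval z = Circ t).
  exists z; split; last by move=> u; apply.
  move=> x Sx; rewrite gleNlt zt; have := tub x Sx; rewrite /gamma.
  by case: (gval x) => r; rewrite /= -?leNgt -?ltNge.
have t0 : 0 < t.
  rewrite lt_neqAle; apply/andP; split; last first.
    by case: S0 => x Sx; apply: le_trans (tub _ Sx); exact: gamma_ge0.
  apply/eqP => t0; apply: nS; case: S0 => x Sx; exists x => //.
  have := tub x Sx; rewrite -t0.
  exact: gval_gamma_le0.
have t1 : t <= 1 by apply: ge_sup => [|_ [x _ <-]]; [case: hs | exact: gamma_le1].
have gt : gval (minus t) = Minus t by rewrite gval_mkG //= t0.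
exists (minus t); split.
  move=> x Sx; have := tub x Sx; rewrite gleNlt gt.
  case: (boolP (gamma x == t)) => [/eqP xt _|xt].
    case E : (gval x) => [r|r] /=; move: (xt); rewrite /gamma E => -> ; first by rewrite ltxx.
    by exfalso; apply: nS; exists x => //; rewrite E; congr Circ; move: xt; rewrite /gamma E.
  rewrite le_eqVlt (negbTE xt) /= /gamma.
  by case: (gval x) => r /= h; rewrite -?leNgt -?ltNge // ltW.
move=> u uub; rewrite leNgt; apply/negP => ut.
have : gamma u < t.
  by move: ut; rewrite gltE gt /gamma; case: (gval u).
move=> /tlt[y Sy /gamma_lt]; rewrite ltNge; move/negP; apply; exact: uub.
Qed.

Lemma gzero_le x : (gzero <= x)%O.
Proof.
rewrite gleNlt /=; case: x => -[r|r] /= /andP[]; rewrite -?leNgt -?ltNge //.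
by move=> h1 h2; case/andP: h1.
Qed.

Lemma gsim_sub_le x y u :
  (forall q : rat, 0 <= q <= 1 -> (y < circ q)%O -> (circ q <= x)%O ->
     (gsub x (circ q) <= u)%O) -> (gsim x y <= u)%O.
Proof.
move=> h; rewrite /gsim /supremum; case: ifPn => _; first exact: gzero_le.
case: xgetP => [z -> [_ zl]|_]; last exact: gzero_le.
by apply: zl => _ [q [h1 h2 h3] <-]; exact: h.
Qed.

Lemma gamma_gsim x y : (y <= x)%O -> gamma (gsim x y) = gamma x - gamma y.
Proof.
move=> yx; set S := [set gsub x (circ q) | q in
    [set q : rat | [/\ 0 <= q <= 1, (y < circ q)%O & (circ q <= x)%O]]].
have circle (q : rat) : gamma y <= ratr q <= gamma x -> 0 <= q <= 1.
  move=> /andP[h1 h2]; rewrite -(ler0q R) -(ler_rat R) rmorph1.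
  by rewrite (le_trans (gamma_ge0 y) h1) (le_trans h2 (gamma_le1 x)).
have Sle z : S z -> gamma z <= gamma x - gamma y.
  move=> [q [h1 h2 h3] <-]; rewrite gamma_gsub // gamma_circ //.
  by rewrite lerD2l lerN2 -gamma_circ // gamma_mono // ltW.
have [xy|xy] := eqVneq (gamma x) (gamma y).
  rewrite xy subrr; apply/eqP; rewrite eq_le gamma_ge0 andbT.
  have -> : 0 = gamma (gzero : Gamma R) by [].
  apply: gamma_mono; apply: gsim_sub_le => q h1 h2 h3.
  have gq : ratr q = gamma x.
    apply/eqP; rewrite eq_le {2}xy -gamma_circ //.
    by rewrite (gamma_mono h3) (gamma_mono (ltW h2)).
  rewrite le_eqVlt; apply/orP; left; apply/eqP/gval_inj.
  rewrite /gsub gval_mkG ?gsub_valid // gval_circ // gq.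
  move: h3; rewrite gleNlt gval_circ // gq /gamma.
  by case E : (gval x) => [r|r] /=; rewrite ?lexx // subrr.
have {}xy : gamma y < gamma x by rewrite lt_neqAle eq_sym xy gamma_mono.
have inS (q : rat) : gamma y < ratr q < gamma x -> S (gsub x (circ q)).
  move=> /andP[h1 h2]; have h : 0 <= q <= 1 by apply: circle; rewrite !ltW.
  exists q => //; split=> //; first by apply: gamma_lt; rewrite gamma_circ.
  by apply/ltW/gamma_lt; rewrite gamma_circ.
have S0 : S !=set0.
  by have [q] := rat_in_itvoo xy; rewrite in_itv /= => /inS hq; exists (gsub x (circ q)).
have [z [zu zl]] := gsupremums_neq0 S0.
have -> : gsim x y = z.
  rewrite /gsim /supremum -/S ifN; last by apply/set0P.
  by apply: xget_subset1 => //; exact: is_subset1_supremums.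
apply/eqP; rewrite eq_le; apply/andP; split; last first.
  rewrite leNgt; apply/negP => h.
  have h' : (Num.max (gamma y) 0 : R) < gamma x - gamma z.
    rewrite gt_max; apply/andP; split; first by rewrite ltrBrDr addrC -ltrBrDr.
    by rewrite subr_gt0 (lt_le_trans h) // gerBl gamma_ge0.
  have [q] := rat_in_itvoo h'; rewrite in_itv /= gt_max => /andP[/andP[h1 _] h2].
  have h3 : gamma y < ratr q < gamma x.
    by rewrite h1 (lt_le_trans h2) // gerBl gamma_ge0.
  have h4 : 0 <= q <= 1 by case/andP: h3 => *; apply: circle; rewrite !ltW.
  have := gamma_mono (zu _ (inS _ h3)); rewrite gamma_gsub; last first.
    by apply/ltW/gamma_lt; rewrite gamma_circ //; case/andP: h3.
  by rewrite gamma_circ // lerBlDr -lerBlDl leNgt h2.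
have [z0|z0] := eqVneq (gamma z) 0; first by rewrite z0 subr_ge0 ltW.
rewrite leNgt; apply/negP => h.
have h1 : (gamma x - gamma y < Num.min (gamma z) 1)%O.
  rewrite lt_min h /=; apply: lt_le_trans h _; exact: gamma_le1.
have [q] := rat_in_itvoo h1; rewrite in_itv /= lt_min => /andP[h2 /andP[h3 h4]].
have hq : 0 <= q <= 1.
  rewrite -(ler0q R) -(ler_rat R) rmorph1 (ltW h4) andbT.
  by apply: le_trans (ltW h2); rewrite subr_ge0 ltW.
have : (z <= circ q)%O.
  by apply: zl => w /Sle hw; apply/ltW/gamma_lt; rewrite gamma_circ // (le_lt_trans hw).
by move=> /gamma_mono; rewrite gamma_circ // leNgt h3.
Qed.

End GammaSup.

Section Measures.
Context {R : realType} {d : Order.disp_t} {D : tbDistrLatticeType d}.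
Local Open Scope order_scope.

Definition is_measureG (mu : D -> Gamma R) : Prop :=
  [/\ {homo mu : a b / a <= b},
      mu \bot = circ 0 /\ mu \top = circ 1
    & forall a b, gsim (mu a) (mu (a `&` b)) <= gsub (mu (a `|` b)) (mu b) /\
                  gsub (mu a) (mu (a `&` b)) >= gsim (mu (a `|` b)) (mu b)].

Definition is_measureI (m : D -> R) : Prop :=
  [/\ forall a, (0 <= m a <= 1)%R,
      {homo m : a b / a <= b >-> (a <= b)%R},
      m \bot = 0%R /\ m \top = 1%R
    & forall a b, (m a + m b = m (a `|` b) + m (a `&` b))%R].

End Measures.

(* As a type, a set of functions carries the topology induced by the topology of
   pointwise convergence, i.e. by the product topology. *)
Definition measureG (R : realType) d (D : tbDistrLatticeType d) :
  set {ptws D -> Gamma R} := [set mu | is_measureG mu].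

(* [0, 1]^D is seen as a subspace of R^D. *)
Definition measureI (R : realType) d (D : tbDistrLatticeType d) :
  set {ptws D -> R} := [set m | is_measureI m].
Arguments measureG R {d} D.
Arguments measureI R {d} D.

Section GammaSharp.
Context {R : realType} {d : Order.disp_t} {D : tbDistrLatticeType d}.
Implicit Types mu : measureG R D.

Lemma gamma_measureI (mu : D -> Gamma R) :
  is_measureG mu -> is_measureI (fun a => gamma (mu a)).
Proof.
move=> [mono [mu0 mu1] mod]; split.
- by move=> a; rewrite gamma_ge0 gamma_le1.
- by move=> a b ab; apply: gamma_mono; exact: mono.
- by rewrite mu0 mu1 !gamma_circ // rmorph0 rmorph1.
- move=> a b; have [h1 h2] := mod a b.
  have ha := mono _ _ (leIl a b); have hb := mono _ _ (leUr b a).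
  move: (gamma_mono h1) (gamma_mono h2).
  rewrite !gamma_gsim // !gamma_gsub // => h3 h4.
  have /eqP : gamma (mu a) - gamma (mu (a `&` b)%O) = gamma (mu (a `|` b)%O) - gamma (mu b).
    by apply/eqP; rewrite eq_le h3.
  by rewrite subr_eq addrAC eq_sym subr_eq eq_sym => /eqP.
Qed.

Definition gamma_sharp mu : measureI R D :=
  exist _ (fun a : D => gamma (set_val mu a) : R)
          (mem_set (gamma_measureI (set_mem (valP mu)))).

Lemma gamma_sharpE mu (a : D) : set_val (gamma_sharp mu) a = gamma (set_val mu a).
Proof. by []. Qed.

End GammaSharp.

Record signature := Signature { relsym : Type; arity : relsym -> nat }.

(* The variable v_(i+1) is represented by [i : nat]; equality is a logical
   symbol. *)
Inductive form (sigma : signature) : Type :=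
| Feq (i j : nat)
| Frel (r : relsym sigma) (t : (arity r).-tuple nat)
| Fbot
| Fneg (phi : form sigma)
| Fand (phi psi : form sigma)
| For (phi psi : form sigma)
| Fex (i : nat) (phi : form sigma).
Arguments Feq {sigma}.
Arguments Frel {sigma}.
Arguments Fbot {sigma}.

HB.instance Definition _ (sigma : signature) := gen_eqMixin (form sigma).
HB.instance Definition _ (sigma : signature) := gen_choiceMixin (form sigma).

Fixpoint free_vars (sigma : signature) (phi : form sigma) : seq nat :=
  match phi with
  | Feq i j => [:: i; j]
  | Frel r t => t
  | Fbot => [::]
  | Fneg phi => free_vars phi
  | Fand phi psi | For phi psi => free_vars phi ++ free_vars psi
  | Fex i phi => [seq j <- free_vars phi | j != i]
  end.

(* Structures are nonempty. *)
Record structure (sigma : signature) := Structure {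
  carrier :> Type;
  carrier_inhabited : inhabited carrier;
  rel_interp : forall r : relsym sigma, (arity r).-tuple carrier -> Prop
}.

Definition update (T : Type) (v : nat -> T) (i : nat) (x : T) : nat -> T :=
  fun j => if j == i then x else v j.

Fixpoint sat (sigma : signature) (B : structure sigma) (v : nat -> B)
    (phi : form sigma) : Prop :=
  match phi with
  | Feq i j => v i = v j
  | Frel r t => rel_interp (map_tuple v t)
  | Fbot => False
  | Fneg phi => ~ sat v phi
  | Fand phi psi => sat v phi /\ sat v psi
  | For phi psi => sat v phi \/ sat v psi
  | Fex i phi => exists x : B, sat (update v i x) phi
  end.

Section LogicalEquivalence.
Context (sigma : signature).

Definition log_equiv (phi psi : form sigma) : bool :=
  `[< forall (B : structure sigma) (v : nat -> B), sat v phi <-> sat v psi >].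

Fact log_equiv_refl : reflexive log_equiv.
Proof. by move=> phi; apply/asboolP. Qed.

Fact log_equiv_sym : symmetric log_equiv.
Proof. by move=> phi psi; apply: asbool_equiv_eq; split=> h B v; rewrite h. Qed.

Fact log_equiv_trans : transitive log_equiv.
Proof.
move=> psi phi chi /asboolP h1 /asboolP h2.
by apply/asboolP => B v; rewrite h1 h2.
Qed.

Canonical log_equiv_rel :=
  EquivRel log_equiv log_equiv_refl log_equiv_sym log_equiv_trans.

Definition FO := {eq_quot log_equiv_rel}.

HB.instance Definition _ : EqQuotient _ log_equiv_rel FO := EqQuotient.on FO.
HB.instance Definition _ := Choice.on FO.

Definition FOclass (phi : form sigma) : FO := \pi_FO phi.

Definition FOn (n : nat) : set FO :=
  [set x | exists2 phi : form sigma,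
     (forall i, i \in free_vars phi -> (i < n)%N) & x = FOclass phi].

Definition satc (B : structure sigma) (v : nat -> B) (x : FO) : Prop :=
  sat v (repr x).

Lemma satcE (B : structure sigma) (v : nat -> B) (phi : form sigma) :
  satc v (FOclass phi) <-> sat v phi.
Proof.
have /eqmodP/asboolP h : repr (FOclass phi) = phi %[mod FO] by rewrite reprK.
exact: h.
Qed.

Lemma FOP (x y : FO) :
  (forall (B : structure sigma) (v : nat -> B), satc v x <-> satc v y) <-> x = y.
Proof.
split=> [h|-> //]; rewrite -[x]reprK -[y]reprK.
by apply/eqmodP/asboolP.
Qed.

Definition FOmeet (x y : FO) : FO := FOclass (Fand (repr x) (repr y)).
Definition FOjoin (x y : FO) : FO := FOclass (For (repr x) (repr y)).
Definition FObot : FO := FOclass Fbot.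
Definition FOtop : FO := FOclass (Fneg Fbot).
Definition FOcompl (x : FO) : FO := FOclass (Fneg (repr x)).

Lemma satc_meet (B : structure sigma) (v : nat -> B) x y :
  satc v (FOmeet x y) <-> satc v x /\ satc v y.
Proof. exact: satcE. Qed.

Lemma satc_join (B : structure sigma) (v : nat -> B) x y :
  satc v (FOjoin x y) <-> satc v x \/ satc v y.
Proof. exact: satcE. Qed.

Lemma satc_bot (B : structure sigma) (v : nat -> B) : satc v FObot <-> False.
Proof. exact: satcE. Qed.

Lemma satc_top (B : structure sigma) (v : nat -> B) : satc v FOtop <-> True.
Proof. by rewrite satcE /=; tauto. Qed.

Lemma satc_compl (B : structure sigma) (v : nat -> B) x :
  satc v (FOcompl x) <-> ~ satc v x.
Proof. exact: satcE. Qed.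

Definition FOle (x y : FO) : bool := FOmeet x y == x.
Definition FOlt (x y : FO) : bool := (y != x) && FOle x y.

Fact FOmeetC : commutative FOmeet.
Proof. by move=> x y; apply/FOP => B v; rewrite !satc_meet; tauto. Qed.
Fact FOjoinC : commutative FOjoin.
Proof. by move=> x y; apply/FOP => B v; rewrite !satc_join; tauto. Qed.
Fact FOmeetA : associative FOmeet.
Proof. by move=> x y z; apply/FOP => B v; rewrite !satc_meet; tauto. Qed.
Fact FOjoinA : associative FOjoin.
Proof. by move=> x y z; apply/FOP => B v; rewrite !satc_join; tauto. Qed.
Fact FOjoinKI y x : FOmeet x (FOjoin x y) = x.
Proof. by apply/FOP => B v; rewrite satc_meet satc_join; tauto. Qed.
Fact FOmeetKU y x : FOjoin x (FOmeet x y) = x.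
Proof. by apply/FOP => B v; rewrite satc_join satc_meet; tauto. Qed.
Fact FOmeetUl : left_distributive FOmeet FOjoin.
Proof.
by move=> x y z; apply/FOP => B v; rewrite !(satc_meet, satc_join); tauto.
Qed.
Fact FOmeetxx : idempotent_op FOmeet.
Proof. by move=> x; apply/FOP => B v; rewrite satc_meet; tauto. Qed.

End LogicalEquivalence.

Fact fo_display : Order.disp_t.
Proof. by constructor. Qed.

HB.instance Definition _ (sigma : signature) :=
  Order.isMeetJoinDistrLattice.Build fo_display (FO sigma)
    (fun _ _ => erefl) (fun _ _ => erefl)
    (@FOmeetC sigma) (@FOjoinC sigma) (@FOmeetA sigma) (@FOjoinA sigma)
    (@FOjoinKI sigma) (@FOmeetKU sigma) (@FOmeetUl sigma) (@FOmeetxx sigma).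

Section FOBoolean.
Context (sigma : signature).

Lemma FOleP (x y : FO sigma) :
  (x <= y)%O <-> forall (B : structure sigma) (v : nat -> B), satc v x -> satc v y.
Proof.
split=> [/eqP/FOP h B v|h]; first by rewrite -(h B v) satc_meet; tauto.
by apply/eqP/FOP => B v; rewrite satc_meet; move: (h B v); tauto.
Qed.

Fact FObot_le (x : FO sigma) : (FObot sigma <= x)%O.
Proof. by apply/FOleP => B v; rewrite satc_bot. Qed.

Fact FOle_top (x : FO sigma) : (x <= FOtop sigma)%O.
Proof. by apply/FOleP => B v; rewrite satc_top. Qed.

HB.instance Definition _ :=
  Order.hasBottom.Build fo_display (FO sigma) FObot_le.
HB.instance Definition _ :=
  Order.hasTop.Build fo_display (FO sigma) FOle_top.

Fact FOjoinxC (x : FO sigma) : (x `|` FOcompl x)%O = \top%O.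
Proof.
by apply/FOP => B v; rewrite satc_top satc_join satc_compl; have := EM (satc v x); tauto.
Qed.

Fact FOmeetxC (x : FO sigma) : (x `&` FOcompl x)%O = \bot%O.
Proof. by apply/FOP => B v; rewrite satc_bot satc_meet satc_compl; tauto. Qed.

HB.instance Definition _ :=
  Order.TBDistrLattice_hasComplement.Build fo_display (FO sigma) FOjoinxC FOmeetxC.

End FOBoolean.

Section Types.
Context (sigma : signature).

Record pointed_structure (n : nat) := PointedStructure {
  pstruct :> structure sigma;
  pval : 'I_n -> pstruct
}.

(* (B, beta) satisfies x. For x in FOn n it does not matter which extension v of
   beta is used, see [satnE]. *)
Definition satn n (p : pointed_structure n) (x : FO sigma) : Prop :=
  forall v : nat -> p, (forall i : 'I_n, v i = pval p i) -> satc v x.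

HB.instance Definition _ n := gen_eqMixin (pointed_structure n).
HB.instance Definition _ n := gen_choiceMixin (pointed_structure n).

Definition elem_equiv n (p q : pointed_structure n) : bool :=
  `[< forall x, FOn n x -> satn p x <-> satn q x >].

Fact elem_equiv_refl n : reflexive (@elem_equiv n).
Proof. by move=> p; apply/asboolP. Qed.

Fact elem_equiv_sym n : symmetric (@elem_equiv n).
Proof. by move=> p q; apply: asbool_equiv_eq; split=> h x hx; rewrite h. Qed.

Fact elem_equiv_trans n : transitive (@elem_equiv n).
Proof.
move=> q p r /asboolP h1 /asboolP h2.
by apply/asboolP => x hx; rewrite h1 // h2.
Qed.

Canonical elem_equiv_rel n :=
  EquivRel (@elem_equiv n) (@elem_equiv_refl n) (@elem_equiv_sym n)
    (@elem_equiv_trans n).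

Definition Typ n := {eq_quot (elem_equiv_rel n)}.
HB.instance Definition _ n : EqQuotient _ (elem_equiv_rel n) (Typ n) :=
  EqQuotient.on (Typ n).
HB.instance Definition _ n := Choice.on (Typ n).

Definition typ n (p : pointed_structure n) : Typ n := \pi_(Typ n) p.

(* [[x]]_n, for x in FOn n *)
Definition typ_ext n (x : FO sigma) : set (Typ n) :=
  [set typ p | p in [set p : pointed_structure n | satn p x]].

End Types.

Record fin_structure (sigma : signature) := FinStructure {
  fstruct :> structure sigma;
  fstruct_fin : Finite fstruct
}.

Definition fin_carrier (sigma : signature) (A : fin_structure sigma) : finType :=
  Finite.Pack (fstruct_fin A).

Section Pairings.
Context (sigma : signature).
Implicit Types (A : fin_structure sigma) (x : FO sigma) (n : nat).

Definition pointed_of_fin A n (alpha : {ffun 'I_n -> fin_carrier A}) : pointed_structure sigma n :=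
  @PointedStructure sigma n A alpha.

Definition stoneI_n (R : realType) A n x : R :=
  #|[pred alpha : {ffun 'I_n -> fin_carrier A} | `[< satn (pointed_of_fin alpha) x >]]|%:R
    / (#|fin_carrier A| ^ n)%:R.

Definition type_weight (R : realType) A n (E : Typ sigma n) : Gamma R :=
  \big[gadd/circ 0]_(alpha : {ffun 'I_n -> fin_carrier A} | typ (pointed_of_fin alpha) == E)
     circ ((#|fin_carrier A| ^ n)%:R^-1).

(* This big operator ranges over the E in typ_ext n x with nonzero weight, which
   are finitely many by [finite_type_weight]. *)
Definition stoneG_n (R : realType) A n x : Gamma R :=
  \big[gadd/circ 0]_(E \in @typ_ext sigma n x) type_weight R A E.

(* Some n with FOn n x; the pairings do not depend on the choice, see
   [stoneI_restr] and [stoneG_restr]. *)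
Definition level x : nat := get [set n | FOn n x].

Definition stoneI_fun (R : realType) A x : R := stoneI_n R A (level x) x.
Definition stoneG_fun (R : realType) A x : Gamma R := stoneG_n R A (level x) x.

End Pairings.

Section FOTheory.
Context (sigma : signature).
Implicit Types (x y : FO sigma) (phi : form sigma).

Lemma sat_ext (B : structure sigma) phi (v w : nat -> B) :
  (forall i, i \in free_vars phi -> v i = w i) -> sat v phi <-> sat w phi.
Proof.
elim: phi v w => [i j|r t||phi IH|phi IH1 psi IH2|phi IH1 psi IH2|i phi IH] v w /= h.
- by rewrite !h // !inE eqxx ?orbT.
- suff -> : map_tuple v t = map_tuple w t by [].
  by apply/val_inj/eq_in_map => i /h.
- by [].
- by rewrite (IH v w).
- by rewrite (IH1 v w) ?(IH2 v w) // => i hi; apply: h; rewrite mem_cat hi ?orbT.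
- by rewrite (IH1 v w) ?(IH2 v w) // => i hi; apply: h; rewrite mem_cat hi ?orbT.
- have E (x : B) : sat (update v i x) phi <-> sat (update w i x) phi.
    apply: IH => j hj; rewrite /update; case: eqP => // /eqP ji.
    by apply: h; rewrite mem_filter ji.
  by split=> -[x /E]; exists x.
Qed.

Definition extend n (p : pointed_structure sigma n) (a : p) : nat -> p :=
  fun i => if insub i is Some j then pval p j else a.

Lemma extendE n (p : pointed_structure sigma n) (a : p) (i : 'I_n) :
  extend a i = pval p i.
Proof. by rewrite /extend valK. Qed.

Lemma satnE n (p : pointed_structure sigma n) x (v : nat -> p) :
  FOn n x -> (forall i : 'I_n, v i = pval p i) -> satn p x <-> satc v x.
Proof.
move=> [phi hphi ->] hv; split=> [|h w hw]; first exact.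
apply/satcE; move/satcE: h; apply: iffLR; apply: sat_ext => i /hphi hi.
by have := hw (Ordinal hi); rewrite -hv /= => ->.
Qed.

Lemma satn_ex n (p : pointed_structure sigma n) :
  exists v : nat -> p, forall x, FOn n x -> satn p x <-> satc v x.
Proof.
have [a] := carrier_inhabited p; exists (extend a) => x hx.
by apply: satnE => // i; rewrite extendE.
Qed.

Lemma FOn_leq m n : (m <= n)%N -> FOn m `<=` FOn (sigma := sigma) n.
Proof. by move=> mn x [phi h ->]; exists phi => // i /h/leq_trans; apply. Qed.

Lemma FOn_level x : FOn (level x) x.
Proof.
suff : exists n, FOn n x by move=> h; apply: (@getPex _ [set n | FOn n x] h).
exists (\max_(i <- free_vars (repr x)) i.+1); exists (repr x).
  by move=> i hi; rewrite (big_rem i hi) /= leq_max ltnSn.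
by rewrite /FOclass reprK.
Qed.

Lemma FOclass_and phi psi :
  FOclass (Fand phi psi) = (FOclass phi `&` FOclass psi)%O.
Proof. by apply/FOP => B v; rewrite satc_meet !satcE. Qed.

Lemma FOclass_or phi psi :
  FOclass (For phi psi) = (FOclass phi `|` FOclass psi)%O.
Proof. by apply/FOP => B v; rewrite satc_join !satcE. Qed.

Lemma FOn_meet n x y : FOn n x -> FOn n y -> FOn n (x `&` y)%O.
Proof.
move=> [phi h1 ->] [psi h2 ->]; exists (Fand phi psi); last by rewrite FOclass_and.
by move=> i /=; rewrite mem_cat => /orP[/h1|/h2].
Qed.

Lemma FOn_join n x y : FOn n x -> FOn n y -> FOn n (x `|` y)%O.
Proof.
move=> [phi h1 ->] [psi h2 ->]; exists (For phi psi); last by rewrite FOclass_or.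
by move=> i /=; rewrite mem_cat => /orP[/h1|/h2].
Qed.

Lemma FOn_bot : FOn 0 (\bot%O : FO sigma).
Proof. by exists Fbot. Qed.

Lemma FOn_top : FOn 0 (\top%O : FO sigma).
Proof. by exists (Fneg Fbot). Qed.

End FOTheory.

Section PairingTheory.
Context (sigma : signature).
Implicit Types (A : fin_structure sigma) (x y : FO sigma) (n : nat).

Definition count_sat A n x : nat :=
  #|[pred alpha : {ffun 'I_n -> fin_carrier A} | `[< satn (pointed_of_fin alpha) x >]]|.

Lemma fin_carrier_gt0 A n : (0 < #|fin_carrier A| ^ n)%N.
Proof.
by rewrite expn_gt0; have [a] := carrier_inhabited A; rewrite (cardD1 (a : fin_carrier A)).
Qed.

Lemma count_satS A n x : FOn n x ->
  count_sat A n.+1 x = (count_sat A n x * #|fin_carrier A|)%N.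
Proof.
move=> hx; set T := fin_carrier A.
pose h (p : {ffun 'I_n -> T} * T) : {ffun 'I_n.+1 -> T} :=
  [ffun i => if unlift ord_max i is Some j then p.1 j else p.2].
have hbij : bijective h.
  exists (fun b : {ffun 'I_n.+1 -> T} =>
            ([ffun i => b (lift ord_max i)], b ord_max)).
    move=> [a t]; congr (_, _); last by rewrite ffunE unlift_none.
    by apply/ffunP => i; rewrite !ffunE liftK.
  by move=> b; apply/ffunP => i; rewrite ffunE; case: unliftP => [j|] ->; rewrite ?ffunE.
have -> : #|T| = #|predT : pred T| by [].
rewrite /count_sat -cardX -[LHS]sum1_card -[RHS]sum1_card.
rewrite (reindex h) /=; last exact: onW_bij.
apply: eq_bigl => -[a t]; rewrite !inE andbT /=.
apply: asbool_equiv_eq.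
have [w hw] := satn_ex (pointed_of_fin (h (a, t))).
pose v := (extend (p := pointed_of_fin (h (a, t))) t).
have hv (i : 'I_n.+1) : v i = h (a, t) i by rewrite /v extendE.
rewrite (satnE (v := v)) //; last exact: FOn_leq hx.
rewrite (satnE (p := pointed_of_fin a) (v := v)) // => i.
have := hv (lift ord_max i); rewrite lift_max => ->.
by rewrite ffunE liftK.
Qed.

Lemma count_satD A n k x : FOn n x ->
  count_sat A (n + k) x = (count_sat A n x * #|fin_carrier A| ^ k)%N.
Proof.
move=> hx; elim: k => [|k IH]; first by rewrite addn0 muln1.
rewrite addnS count_satS; last exact: FOn_leq (leq_addr _ _) _ hx.
by rewrite IH expnSr mulnA.
Qed.

Definition freq (F : numFieldType) A n x : F :=
  (count_sat A n x)%:R / (#|fin_carrier A| ^ n)%:R.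

Lemma freq_leq (F : numFieldType) A m n x : (m <= n)%N -> FOn m x ->
  freq F A n x = freq F A m x.
Proof.
move=> /subnKC <- hx; rewrite /freq count_satD // expnD !natrM.
by rewrite -mulf_div divff ?mulr1 // pnatr_eq0 -lt0n fin_carrier_gt0.
Qed.

Lemma freq_eq (F : numFieldType) A m n x : FOn m x -> FOn n x ->
  freq F A n x = freq F A m x.
Proof.
move=> hm hn; case: (leqP m n) => [mn|/ltnW mn]; first exact: freq_leq.
by rewrite (freq_leq F A mn hn).
Qed.

Lemma freq_ge0 (F : numFieldType) A n x : 0 <= freq F A n x.
Proof. by rewrite divr_ge0. Qed.

Lemma freq_le1 (F : numFieldType) A n x : freq F A n x <= 1.
Proof.
rewrite ler_pdivrMr ?ltr0n ?fin_carrier_gt0 // mul1r ler_nat.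
by rewrite (leq_trans (max_card _)) // card_ffun card_ord.
Qed.

Lemma freq_mono (F : numFieldType) A n x y : (x <= y)%O ->
  freq F A n x <= freq F A n y.
Proof.
move=> /FOleP xy; rewrite ler_wpM2r ?invr_ge0 // ler_nat.
apply/subset_leq_card/fintype.subsetP => a; rewrite !inE => h.
by move=> v hv; apply/xy/h.
Qed.

Lemma freq_bot (F : numFieldType) A : freq F A 0 \bot%O = 0.
Proof.
rewrite /freq /count_sat eq_card0 ?mul0r // => a; rewrite !inE.
apply: asboolF; have [v hv] := satn_ex (pointed_of_fin a).
by rewrite hv ?satc_bot //; exact: FOn_bot.
Qed.

Lemma freq_top (F : numFieldType) A : freq F A 0 \top%O = 1.
Proof.
have -> : freq F A 0 \top%O = #|{ffun 'I_0 -> fin_carrier A}|%:R / 1%:R.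
  congr (_%:R / _); apply: eq_card => a; rewrite !inE.
  by apply: asboolT => v hv; rewrite satc_top.
by rewrite card_ffun card_ord expn0 divr1.
Qed.

Lemma freq_mod (F : numFieldType) A n x y : FOn n x -> FOn n y ->
  freq F A n x + freq F A n y = freq F A n (x `|` y)%O + freq F A n (x `&` y)%O.
Proof.
move=> hx hy; rewrite /freq -!mulrDl -!natrD; congr (_%:R / _).
rewrite /count_sat -cardUI; congr (_ + _)%N; apply: eq_card => a; rewrite !inE.
  have [v hv] := satn_ex (pointed_of_fin a).
  rewrite -asbool_or; apply: asbool_equiv_eq.
  by rewrite !hv ?satc_join //; exact: FOn_join.
have [v hv] := satn_ex (pointed_of_fin a).
rewrite -asbool_and; apply: asbool_equiv_eq.
by rewrite !hv ?satc_meet //; exact: FOn_meet.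
Qed.

Lemma stoneI_nE (R : realType) A n x : stoneI_n R A n x = freq R A n x.
Proof. by []. Qed.

End PairingTheory.

Section GammaSums.
Context {R : realType}.

Lemma gadd_circ (p q : rat) : 0 <= p -> 0 <= q -> p + q <= 1 ->
  gadd (circ p) (circ q) = circ (p + q) :> Gamma R.
Proof.
move=> p0 q0 pq1; rewrite /gadd !gval_circ ?p0 ?q0 /=; last 2 first.
- by rewrite (le_trans _ pq1) // lerDr.
- by rewrite (le_trans _ pq1) // lerDl.
by rewrite -rmorphD.
Qed.

Lemma gsub_circ (p q : rat) : 0 <= q -> q <= p -> p <= 1 ->
  gsub (circ p) (circ q) = circ (p - q) :> Gamma R.
Proof.
move=> q0 qp p1; rewrite /gsub !gval_circ ?p1 ?q0 ?(le_trans q0 qp) ?(le_trans qp p1) //=.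
by rewrite -rmorphB.
Qed.

Lemma circ_le (p q : rat) : 0 <= p <= 1 -> 0 <= q <= 1 ->
  (circ p <= circ q :> Gamma R)%O = (p <= q).
Proof. by move=> hp hq; rewrite gleNlt !gval_circ //= -leNgt ler_rat. Qed.

Lemma big_gadd_circ (I : Type) (s : seq I) (P : pred I) (F : I -> rat) :
  (forall i, 0 <= F i) -> \sum_(i <- s | P i) F i <= 1 ->
  \big[gadd/circ 0]_(i <- s | P i) circ (F i) =
  circ (\sum_(i <- s | P i) F i) :> Gamma R.
Proof.
move=> F0; elim: s => [|i s IH]; first by rewrite !big_nil.
rewrite !big_cons; case: ifP => // _ h.
have s0 : 0 <= \sum_(j <- s | P j) F j by apply: sumr_ge0.
by rewrite IH ?gadd_circ // (le_trans _ h) // lerDr.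
Qed.

End GammaSums.

Section StoneGamma.
Context (R : realType) (sigma : signature).
Implicit Types (A : fin_structure sigma) (x y : FO sigma) (n : nat).

Let card_E A n (E : Typ sigma n) : nat :=
  #|[pred alpha : {ffun 'I_n -> fin_carrier A} | typ (pointed_of_fin alpha) == E]|.

Lemma type_weightE A n E :
  type_weight R A E = circ ((@card_E A n E)%:R / (#|fin_carrier A| ^ n)%:R).
Proof.
have E1 : \sum_(alpha : {ffun 'I_n -> fin_carrier A} | typ (pointed_of_fin alpha) == E)
    ((#|fin_carrier A| ^ n)%:R^-1 : rat)
  = (card_E A E)%:R / (#|fin_carrier A| ^ n)%:R.
  by rewrite sumr_const -[LHS]mulr_natl.
rewrite /type_weight big_gadd_circ ?E1 //.
rewrite ler_pdivrMr ?ltr0n ?fin_carrier_gt0 // mul1r ler_nat.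
by rewrite (leq_trans (max_card _)) // card_ffun card_ord.
Qed.

Lemma type_weight_neq0 A n (E : Typ sigma n) : type_weight R A E != circ 0 ->
  exists alpha : {ffun 'I_n -> fin_carrier A}, typ (pointed_of_fin alpha) = E.
Proof.
rewrite type_weightE; have [->|] := posnP (card_E A E); first by rewrite mul0r eqxx.
by move=> /card_gt0P[a ha] _; exists a; exact: (eqP ha).
Qed.

Lemma type_weight_fin A n (alpha : {ffun 'I_n -> fin_carrier A}) :
  type_weight R A (typ (pointed_of_fin alpha)) != circ 0.
Proof.
rewrite type_weightE; set q := _ / _.
have q0 : 0 < q.
  rewrite divr_gt0 // ltr0n ?fin_carrier_gt0 //.
  by apply/card_gt0P; exists alpha; rewrite inE.
have q1 : q <= 1.
  rewrite ler_pdivrMr ?ltr0n ?fin_carrier_gt0 // mul1r ler_nat.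
  by rewrite (leq_trans (max_card _)) // card_ffun card_ord.
apply/eqP => /(congr1 (@gamma R)); rewrite !gamma_circ ?(ltW q0) ?q1 //.
by rewrite rmorph0 => /eqP; rewrite fmorph_eq0 gt_eqF.
Qed.

Lemma finite_type_weight A n (S : set (Typ sigma n)) :
  finite_set (S `&` (fun E => type_weight R A E) @^-1` [set~ circ 0]).
Proof.
have hf : finite_set (range (fun alpha : {ffun 'I_n -> fin_carrier A} =>
   typ (pointed_of_fin alpha))) by exact: finite_image.
apply: sub_finite_set hf => E [_ /= /eqP/type_weight_neq0[a <-]].
by exists a.
Qed.

Lemma typ_extP n x (p : pointed_structure sigma n) : FOn n x ->
  @typ_ext sigma n x (typ p) <-> satn p x.
Proof.
move=> hx; split=> [[q hq /eqmodP/asboolP h]|h]; last by exists p.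
by rewrite -h.
Qed.

Lemma stoneG_nE A n x : FOn n x -> stoneG_n R A n x = circ (freq rat A n x).
Proof.
move=> hx; rewrite /stoneG_n; set s := finite_support _ _ _.
have sP E : (E \in s) = (E \in @typ_ext sigma n x `&`
    (fun E => type_weight R A E) @^-1` [set~ circ 0]).
  by apply: in_finite_support; exact: finite_type_weight.
have E1 : \sum_(E <- s) ((card_E A E)%:R / (#|fin_carrier A| ^ n)%:R : rat)
    = freq rat A n x.
  rewrite -mulr_suml -natr_sum; congr (_%:R / _).
  transitivity (\sum_(E <- s) \sum_(a : {ffun 'I_n -> fin_carrier A})
     (typ (pointed_of_fin a) == E : nat))%N.
    apply: eq_bigr => E _; rewrite /card_E -sum1_card big_mkcond /=.
    by apply: eq_bigr => a _; rewrite inE; case: ifP.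
  rewrite exchange_big /= /count_sat -sum1_card [RHS]big_mkcond /=.
  apply: eq_bigr => a _; rewrite inE.
  transitivity (typ (pointed_of_fin a) \in s : nat).
    rewrite -count_uniq_mem; last exact: finite_support_uniq.
    rewrite -sum1_count [RHS]big_mkcond /=.
    by apply: eq_bigr => E _; rewrite eq_sym; case: eqP.
  have -> : (typ (pointed_of_fin a) \in s) = `[< satn (pointed_of_fin a) x >].
    rewrite sP; apply/idP/asboolP => [|h].
      by rewrite inE => -[/typ_extP -/(_ hx)].
    rewrite inE; split; first by apply/typ_extP.
    by apply/eqP; exact: type_weight_fin.
  by case: asboolP.
under eq_bigr do rewrite type_weightE.
rewrite big_gadd_circ ?E1 //; last exact: freq_le1.
Qed.

Lemma stoneG_funE A n x : FOn n x -> stoneG_fun R A x = circ (freq rat A n x).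
Proof.
move=> hx; rewrite /stoneG_fun stoneG_nE; last exact: FOn_level.
by rewrite (freq_eq rat A hx (FOn_level x)).
Qed.

Lemma stoneI_funE A n x : FOn n x -> stoneI_fun R A x = freq R A n x.
Proof.
by move=> hx; rewrite /stoneI_fun stoneI_nE (freq_eq R A hx (FOn_level x)).
Qed.

Lemma FOn_common x y : exists2 n, FOn n x & FOn n y.
Proof.
exists (maxn (level x) (level y)).
  exact: FOn_leq (leq_maxl _ _) _ (FOn_level x).
exact: FOn_leq (leq_maxr _ _) _ (FOn_level y).
Qed.

Lemma stoneI_measure A : is_measureI (stoneI_fun R A).
Proof.
split.
- by move=> x; rewrite (stoneI_funE A (FOn_level x)) freq_ge0 freq_le1.
- move=> x y xy; have [n hx hy] := FOn_common x y.
  by rewrite (stoneI_funE A hx) (stoneI_funE A hy) freq_mono.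
- by rewrite (stoneI_funE A (FOn_bot sigma)) (stoneI_funE A (FOn_top sigma))
    freq_bot freq_top.
- move=> x y; have [n hx hy] := FOn_common x y.
  rewrite (stoneI_funE A hx) (stoneI_funE A hy) (stoneI_funE A (FOn_join hx hy)).
  by rewrite (stoneI_funE A (FOn_meet hx hy)) freq_mod.
Qed.

Lemma gsim_gsub_circ (p q r s : rat) :
  0 <= q -> q <= p -> p <= 1 -> 0 <= s -> s <= r -> r <= 1 -> p - q = r - s ->
  (gsim (circ p) (circ q) <= gsub (circ r) (circ s) :> Gamma R)%O.
Proof.
move=> q0 qp p1 s0 sr r1 e; apply: gsim_sub_le => t /andP[t0 t1] qt tp.
have p0 := le_trans q0 qp; have q1 := le_trans qp p1.
have {}tp : t <= p by move: tp; rewrite circ_le ?t0 ?p0.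
have {}qt : q <= t by move/ltW: qt; rewrite circ_le ?t0 ?q0.
rewrite !gsub_circ // -e circ_le ?lerD2l ?lerN2 //.
  by rewrite subr_ge0 tp (le_trans _ p1) // gerBl.
by rewrite subr_ge0 qp (le_trans _ p1) // gerBl.
Qed.

Lemma stoneG_measure A : is_measureG (stoneG_fun R A).
Proof.
have fP n x : 0 <= freq rat A n x <= 1 by rewrite freq_ge0 freq_le1.
split.
- move=> x y xy; have [n hx hy] := FOn_common x y.
  by rewrite (stoneG_funE A hx) (stoneG_funE A hy) circ_le // freq_mono.
- by rewrite (stoneG_funE A (FOn_bot sigma)) (stoneG_funE A (FOn_top sigma))
    freq_bot freq_top.
- move=> x y; have [n hx hy] := FOn_common x y.
  rewrite (stoneG_funE A hx) (stoneG_funE A hy) (stoneG_funE A (FOn_join hx hy)).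
  rewrite (stoneG_funE A (FOn_meet hx hy)).
  have e : freq rat A n x - freq rat A n (x `&` y)%O
         = freq rat A n (x `|` y)%O - freq rat A n y.
    by apply/eqP; rewrite subr_eq addrAC eq_sym subr_eq eq_sym freq_mod.
  split; apply: gsim_gsub_circ; rewrite ?freq_ge0 ?freq_le1 ?freq_mono ?leIl ?leUr //.
Qed.

(* Isomorphic structures have equal pairings, so that the ranges of these two
   maps are the images of the set of isomorphism classes of finite structures. *)
Definition stoneG A : measureG R (FO sigma) :=
  exist _ (stoneG_fun R A : {ptws FO sigma -> Gamma R}) (mem_set (stoneG_measure A)).

Definition stoneI A : measureI R (FO sigma) :=
  exist _ (stoneI_fun R A : {ptws FO sigma -> R}) (mem_set (stoneI_measure A)).

Lemma stoneG_restr A n x : FOn n x -> set_val (stoneG A) x = stoneG_n R A n x.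
Proof. by move=> hx; rewrite stoneG_nE // -stoneG_funE. Qed.

Lemma stoneI_restr A n x : FOn n x -> set_val (stoneI A) x = stoneI_n R A n x.
Proof. exact: stoneI_funE. Qed.

End StoneGamma.

(* Main.v *)
(** Identify a point x of Gamma with its cut, the set of rationals q with
    q° <= x. The inclusion from left to right holds because gamma is continuous.
    Conversely, a point m of the closure of the classical Stone pairings is their
    limit along an ultrafilter U on finite structures. Let mu(phi) be the point of
    Gamma whose cut consists of the q that are <= <phi, A> for U-almost all A: the
    Gamma-valued pairings converge to mu along U, so gamma o mu = m, and the
    modularity of the rational pairings passes to the limit, giving the two
    semicontinuous inequalities that define a Gamma-valued measure. *)

Require Import Defs.
From mathcomp Require Import all_boot all_order all_algebra.
From mathcomp Require Import finmap lra.
From mathcomp Require Import all_classical all_reals all_analysis.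
Import Order.TTheory GRing.Theory Num.Theory.
Import numFieldNormedType.Exports.
Local Open Scope classical_set_scope.
Local Open Scope ring_scope.

Set Implicit Arguments.
Unset Strict Implicit.
Unset Printing Implicit Defensive.

(** * Points of [Gamma] as lower sets of rationals *)

Section Cuts.
Context {R : realType}.
Implicit Types (x y : Gamma R) (p q : rat).

(* For q in [0, 1] this is q° <= x, see [circ_leE]; allowing every rational q
   makes cuts compatible with addition without range conditions. *)
Definition cut x : pred rat := fun q => ~~ gsymb_lt (gval x) (Circ (ratr q)).

Lemma circ_leE q x : 0 <= q <= 1 -> (circ q <= x)%O = cut x q.
Proof. by move=> h; rewrite gleNlt gval_circ. Qed.

Lemma cut_circ p q : 0 <= p <= 1 -> cut (circ p : Gamma R) q = (q <= p).
Proof. by move=> h; rewrite /cut gval_circ //= -leNgt ler_rat. Qed.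

Lemma cut_lower x p q : p <= q -> cut x q -> cut x p.
Proof.
rewrite -(ler_rat R) /cut; case: (gval x) => r /= pq; rewrite -?leNgt -?ltNge.
  exact: le_lt_trans.
exact: le_trans.
Qed.

Lemma cut_le0 x q : q <= 0 -> cut x q.
Proof.
move=> q0; apply: cut_lower q0 _.
by rewrite -circ_leE // circ0 gzero_le.
Qed.

Lemma cut_gt1 x q : 1 < q -> ~~ cut x q.
Proof.
rewrite -(ltr_rat R) rmorph1 /cut negbK; case: x => -[r|r] /= h.
  by case/andP: h => _ /le_trans h /ltW /h.
by case/andP: h => /andP[_ /le_lt_trans h] _ /h.
Qed.

Lemma cut_lt_gamma x q : ratr q < gamma x -> cut x q.
Proof. by rewrite /cut /gamma; case: (gval x) => r /= h; rewrite -?leNgt -?ltNge // ltW. Qed.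

Lemma cut_le_gamma x q : cut x q -> ratr q <= gamma x.
Proof. by rewrite /cut /gamma; case: (gval x) => r /=; rewrite -?leNgt -?ltNge // => /ltW. Qed.

Lemma le_cut x y : (forall q, cut x q -> cut y q) -> (x <= y)%O.
Proof.
move=> h; rewrite leNgt; apply/negP => yx.
suff [q hx /negP[]] : exists2 q, cut x q & ~~ cut y q by exact: h.
move: yx; rewrite gltE /cut; case: x y {h} => [[s|s] hx] [[r|r] hy] /= rs.
- have [q] := rat_in_itvoo rs; rewrite in_itv /= => /andP[h1 h2].
  by exists q; rewrite ?negbK -?ltNge // ltW.
- have [q] := rat_in_itvoo rs; rewrite in_itv /= => /andP[h1 h2].
  by exists q; rewrite ?negbK -?ltNge // ltW.
(* When [r = s] no rational lies strictly between, but [s] is itself rational and separates r^- from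
   s°. *)
- case/andP: hx => _ /asboolP[q sq]; exists q; last by rewrite negbK -sq.
  by rewrite -leNgt sq.
- have [q] := rat_in_itvoo rs; rewrite in_itv /= => /andP[h1 h2].
  by exists q; rewrite ?negbK // -leNgt ltW.
Qed.

Lemma cut_inj x y : cut x =1 cut y -> x = y.
Proof. by move=> h; apply/le_anti; rewrite !le_cut // => q; rewrite h. Qed.

Lemma cut_gsub_circ x p q : 0 <= q <= 1 -> (circ q <= x)%O ->
  cut (gsub x (circ q)) p = cut x (p + q).
Proof.
move=> hq qx; rewrite /cut /gsub gval_mkG ?gsub_valid // gval_circ // rmorphD.
by case: (gval x) => r /=; rewrite -?leNgt -?ltNge (ltrBrDr, lerBrDr).
Qed.

(** By contraposition: if [p] lies outside the cut of x - y, the cut of [y] comes close enough to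
    the real part of [y] to contain some [q] with [q + p] outside the cut of [x]. *)
Lemma cut_gsub x y p : (y <= x)%O ->
  (forall q, cut y q -> cut x (q + p)) -> cut (gsub x y) p.
Proof.
move=> yx h; have := gsub_valid yx; apply: contraPT => np vg.
suff [q hy /negP[]] : exists2 q, cut y q & ~~ cut x (q + p) by exact: h.
move: np; rewrite /cut /gsub gval_mkG // !negbK => {h vg yx}.
have itv (r s : R) : r - s < ratr p ->
    exists2 q : rat, ratr q < s & r < ratr q + ratr p.
  rewrite ltrBlDr -ltrBlDl => /rat_in_itvoo[q]; rewrite in_itv /= => /andP[h1 h2].
  by exists q; rewrite // -ltrBlDr.
(* For y = s^- the witness must lie strictly below [s], which requires [r - s < ratr p]. If [r - s]
   is rational, x - y is (r - s)° and strictness is immediate; if not, [r - s] cannot equal the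
   rational [p]. *)
have irr (r s : R) : ~~ israt (r - s) -> r - s <= ratr p -> r - s < ratr p.
  by rewrite le_eqVlt => + /predU1P[e|//]; rewrite e israt_ratr.
case: x y => [[r|r] hx] [[s|s] hy] /=.
- case: ifPn => [_ /itv|/irr h /h /itv] [q h1 h2]; exists q;
    by rewrite ?negbK -?ltNge // rmorphD ltW.
- move: hy => /andP[_ /asboolP[q ->]] h; exists q; first by rewrite -leNgt.
  by rewrite negbK rmorphD -lerBlDl.
- case: ifPn => [_ /itv|/irr h /h /itv] [q h1 h2]; exists q;
    by rewrite ?negbK -?ltNge // rmorphD.
- move: hy => /andP[_ /asboolP[q ->]] h; exists q; first by rewrite -leNgt.
  by rewrite negbK rmorphD -ltrBlDl.
Qed.

(** The real part of the point is the supremum [t] of [C]: the point is t° if [t] is attained in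
    [C], and t^- if [C] consists of the rationals strictly below [t]. *)
Lemma gamma_of_cut (C : set rat) :
  (forall q, q <= 0 -> C q) -> (forall q, C q -> q <= 1) ->
  (forall p q, p <= q -> C q -> C p) -> exists x, forall q, cut x q <-> C q.
Proof.
move=> C0 C1 Cl; pose S : set R := [set ratr q | q in C]; pose t := sup S.
have S0 : S 0 by exists 0; [apply: C0|rewrite rmorph0].
have hS : has_sup S.
  split; first by exists 0.
  by exists 1 => _ [q /C1 q1 <-]; rewrite -(rmorph1 ratr) ler_rat.
have tub q : C q -> ratr q <= t.
  by move=> Cq; apply: ub_le_sup; [case: hS|exists q].
have Clt q : ratr q < t -> C q.
  move=> qt; have d0 : 0 < t - ratr q by rewrite subr_gt0.
  have [_ [p Cp <-]] := sup_adherent d0 hS.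
  by rewrite opprB addrC subrK ltr_rat => /ltW /Cl; apply.
have t0 : 0 <= t by apply: ub_le_sup => //; case: hS.
have t1 : t <= 1.
  by apply: ge_sup => [|_ [q /C1 q1 <-]]; [exists 0|rewrite -(rmorph1 ratr) ler_rat].
have [[q0 Cq0 q0t]|nS] := pselect (exists2 q, C q & ratr q = t).
  have q01 : 0 <= q0 <= 1 by rewrite -(ler0q R) -(ler_rat R) rmorph1 q0t t0.
  exists (circ q0) => q; rewrite cut_circ //; split=> [/Cl|/tub]; first exact.
  by rewrite -q0t ler_rat.
(* The symbol t^- exists only for t > 0; as 0 lies in [C], a supremum equal to 0 would be
   attained. *)
have {}t0 : 0 < t.
  rewrite lt_neqAle t0 andbT; apply/eqP => t0'; apply: nS; exists 0; first exact: C0.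
  by rewrite rmorph0.
exists (minus t) => q; rewrite /cut gval_mkG /= ?t0 // -ltNge; split=> [/Clt//|Cq].
by rewrite lt_neqAle tub // andbT; apply/eqP => qt; apply: nS; exists q.
Qed.

End Cuts.

(** * The topology of [Gamma] in terms of cuts *)

Section GammaTopology.
Context {R : realType}.
Implicit Types (x : Gamma R) (q : rat).

Lemma gamma_subbase_open (U : set (Gamma R)) : gamma_subbase U -> open U.
Proof.
move=> sU; exists [set U]; last by rewrite bigcup_set1.
move=> _ ->; exists [fset U]%fset; first by move=> V /fset1P ->; rewrite inE.
rewrite predeqE => y; split=> [|Uy V /fset1P -> //]; apply; exact/fset1P.
Qed.

Lemma open_cut q : open [set x : Gamma R | cut x q].
Proof.
have [q0|q0] := leP q 0.
  by rewrite (_ : mkset _ = setT); [exact: openT|apply/seteqP; split=> // x _; exact: cut_le0].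
have [q1|q1] := leP q 1; last first.
  rewrite (_ : mkset _ = set0); first exact: open0.
  by apply/seteqP; split=> // x /=; apply/negP/cut_gt1.
apply: gamma_subbase_open; left; exists q; first by rewrite ltW.
by apply/seteqP; split=> x /=; rewrite circ_leE // ltW.
Qed.

(** The point q^- is the immediate predecessor of q°, so subbasic sets of the second kind are
    complements of subbasic sets of the first kind. *)
Lemma le_minusE q x : 0 < q <= 1 -> (x <= minus (ratr q))%O = ~~ cut x q.
Proof.
move=> /andP[q0 q1]; rewrite gleNlt /cut gval_mkG /=; last first.
  by rewrite ltr0q q0 -(rmorph1 ratr) ler_rat.
by case: (gval x) => r /=; rewrite negbK -?leNgt -?ltNge.
Qed.

Lemma open_cutC q : open [set x : Gamma R | ~~ cut x q].
Proof.
have [q0|q0] := leP q 0.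
  rewrite (_ : mkset _ = set0); first exact: open0.
  by apply/seteqP; split=> // x /=; rewrite cut_le0.
have [q1|q1] := leP q 1; last first.
  by rewrite (_ : mkset _ = setT); [exact: openT|apply/seteqP; split=> // x _; exact: cut_gt1].
apply: gamma_subbase_open; right; exists q; first by rewrite q0.
by apply/seteqP; split=> x /=; rewrite le_minusE // q0.
Qed.

(** A basic neighbourhood is a finite intersection of subbasic sets, each of which says that one
    rational lies in the cut or outside it. *)
Lemma cvg_gamma (F : set_system (Gamma R)) x : Filter F ->
  (forall q, cut x q -> F [set y | cut y q]) ->
  (forall q, ~~ cut x q -> F [set y | ~~ cut y q]) -> F --> x.
Proof.
move=> FF h1 h2 A; rewrite nbhsE => -[_ [[B sB <-] [C BC Cx]] sBA].
rewrite nbhs_filterE; apply: filterS sBA _; apply: (@filterS _ _ _ C).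
  by move=> ? ?; exists C.
have [D sD IDeC] := sB _ BC; rewrite -IDeC; apply: filter_bigI => E DE.
have : E x by move: Cx; rewrite -IDeC => /(_ _ DE).
have := sD _ DE; rewrite inE => -[[q hq ->]|[q hq ->]] /=.
  by rewrite circ_leE // => /h1; apply: filterS => y /=; rewrite circ_leE.
by rewrite le_minusE // => /h2; apply: filterS => y /=; rewrite le_minusE.
Qed.

Lemma continuous_gamma : continuous (@gamma R).
Proof.
move=> x; apply/(@cvgrPdist_le _ _ _ _ (nbhs_filter x)) => e e0.
have /rat_in_itvoo[p] : gamma x - e < gamma x by rewrite gtrBl.
rewrite in_itv /= => /andP[p1 p2].
have /rat_in_itvoo[q] : gamma x < gamma x + e by rewrite ltrDl.
rewrite in_itv /= => /andP[q1 q2].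
(* Having [p] in the cut and [q] outside it are open conditions, and together they force [gamma y]
   into [p, q]. *)
have hp : \forall y \near x, cut y p.
  by apply: open_nbhs_nbhs; split; [exact: open_cut|exact: cut_lt_gamma].
have hq : \forall y \near x, ~~ cut y q.
  apply: open_nbhs_nbhs; split; first exact: open_cutC.
  by apply/negP => /cut_le_gamma; rewrite leNgt q1.
apply: filterS (filterI hp hq) => y [yp yq] /=; rewrite ler_distlC; apply/andP; split.
  exact: le_trans (ltW p1) (cut_le_gamma yp).
by apply: le_trans (ltW q2); rewrite leNgt; apply: contra yq => /cut_lt_gamma.
Qed.

End GammaTopology.

(** * Coordinatewise convergence in subspaces of a product *)

Section PointwiseSubspace.
Context {I : choiceType} {V : topologicalType} (S : set {ptws I -> V}).

Lemma set_val_eval_continuous (i : I) : continuous (fun f : S => set_val f i).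
Proof.
move=> f; apply: (@continuous_comp S {ptws I -> V} V set_val (@proj I (fun=> V) i)).
  exact: initial_continuous.
exact: proj_continuous.
Qed.

Lemma cvg_set_val_eval (F : set_system S) (f : S) : Filter F ->
  (forall i, (fun g : S => set_val g i) @ F --> set_val f i) -> F --> f.
Proof.
move=> FF h A [_ [[B oB <-] Bf] sBA].
have : (set_val @ F) --> (set_val f : {ptws I -> V}).
  apply/cvg_sup => i C [_ [[D oD <-] Df] sDC].
  by apply: filterS sDC _; apply: (h i); exact: open_nbhs_nbhs.
move=> /(_ B (open_nbhs_nbhs (conj oB Bf))) FB; exact: filterS sBA FB.
Qed.

End PointwiseSubspace.

(** * Limits of rational values along an ultrafilter *)

Section Ultralimits.
Context {R : realType} {T : Type} (U : set_system T) {UU : UltraFilter U}.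

(** For [v] with values in [0, 1] this makes [circ (v t)] converge to [x] along [U], see
    [cvg_circ_cut_limit]; in this form rational inequalities pass to the limit. *)
Definition is_cut_limit (v : T -> rat) (x : Gamma R) :=
  forall q, cut x q <-> U [set t | q <= v t].

Lemma cut_limit_exists (v : T -> rat) :
  (forall t, 0 <= v t <= 1) -> exists x, is_cut_limit v x.
Proof.
move=> v01; apply: gamma_of_cut => [q q0|q /filter_ex[t /= qv]|p q pq].
- by apply: nearW => t; case/andP: (v01 t) => /(le_trans q0).
- by case/andP: (v01 t) => _; exact: le_trans.
- by apply: filterS => t /=; exact: le_trans.
Qed.

(** An ultrafilter contains the set of [t] with [q <= v t] or its complement, so absence from the
    cut also holds eventually along [U]. *)
Lemma is_cut_limitN (v : T -> rat) x q :
  is_cut_limit v x -> ~~ cut x q -> U [set t | v t < q].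
Proof.
move=> vx /negP xq; have [|] := in_ultra_setVsetC [set t | q <= v t] UU.
  by move=> /vx.
by apply: filterS => t /= /negP; rewrite -ltNge.
Qed.

Lemma cvg_circ_cut_limit (v : T -> rat) x : (forall t, 0 <= v t <= 1) ->
  is_cut_limit v x -> (fun t => circ (v t) : Gamma R) @ U --> x.
Proof.
move=> v01 vx; apply: cvg_gamma => q xq.
  by move/vx: xq; apply: (@filterS _ U) => t /=; rewrite cut_circ.
by move/(is_cut_limitN vx): xq; apply: (@filterS _ U) => t /=; rewrite cut_circ // -ltNge.
Qed.

Lemma le_cut_limit (v w : T -> rat) x y : is_cut_limit v x -> is_cut_limit w y ->
  (forall t, v t <= w t) -> (x <= y)%O.
Proof.
move=> vx wy vw; apply: le_cut => q /vx h; apply/wy; apply: filterS h => t /=.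
by move=> /le_trans; apply.
Qed.

Lemma cut_limit_cst (v : T -> rat) p x : 0 <= p <= 1 -> (forall t, v t = p) ->
  is_cut_limit v x -> x = circ p.
Proof.
move=> p01 vp vx; apply: cut_inj => q; rewrite cut_circ //.
apply/idP/idP => [/vx/filter_ex[t /=]|qp]; first by rewrite vp.
by apply/vx; apply: nearW => t; rewrite /= vp.
Qed.

(* The q° in the join defining [gsim x y] are strictly above y, so that
   eventually [b t < q]; this is why [gsim], not [gsub], stands on the left. *)
Lemma gsim_gsub_cut_limit (a b c d : T -> rat) x y z w :
  is_cut_limit a x -> is_cut_limit b y -> is_cut_limit c z -> is_cut_limit d w ->
  (forall t, a t - b t = c t - d t) -> (w <= z)%O ->
  (gsim x y <= gsub z w)%O.
Proof.
move=> ax by_ cz dw abcd wz; apply: gsim_sub_le => q q01 yq qx.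
apply: le_cut => p; rewrite cut_gsub_circ // => /ax pa.
apply: cut_gsub => // t /dw td; apply/cz.
have bq : U [set i | b i < q] by apply: is_cut_limitN by_ _; rewrite -circ_leE // -ltNge.
apply: filterS (filterI (filterI pa td) bq) => i /= [[h1 h2] h3].
by have := abcd i; lra.
Qed.

(** The hypothesis is over [R] so that [stoneI_measure] supplies it; as [ratr] is an order embedding
    of fields, the measure axioms hold for the rational values themselves. *)
Lemma measureG_cut_limit d (D : tbDistrLatticeType d) (v : T -> D -> rat)
    (mu : D -> Gamma R) :
  (forall t, is_measureI (fun x => ratr (v t x) : R)) ->
  (forall x, is_cut_limit (fun t => v t x) (mu x)) -> is_measureG mu.
Proof.
move=> vm mul.
have v_homo t : {homo v t : x y / (x <= y)%O >-> x <= y}.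
  by case: (vm t) => _ h _ _ x y /h; rewrite ler_rat.
have v_mod t x y : v t x + v t y = v t (x `|` y)%O + v t (x `&` y)%O.
  by case: (vm t) => _ _ _ /(_ x y); rewrite -!rmorphD => /fmorph_inj.
have mu_homo x y : (x <= y)%O -> (mu x <= mu y)%O.
  by move=> xy; apply: le_cut_limit (mul x) (mul y) _ => t; exact: v_homo.
split=> //.
- have v_bot t : v t \bot%O = 0.
    by apply: (fmorph_inj (ratr : rat -> R)); rewrite rmorph0; case: (vm t) => _ _ [].
  have v_top t : v t \top%O = 1.
    by apply: (fmorph_inj (ratr : rat -> R)); rewrite rmorph1; case: (vm t) => _ _ [].
  by split; [apply: cut_limit_cst v_bot (mul _)|apply: cut_limit_cst v_top (mul _)].
(* Both halves come from modularity in the form v(x) - v(x ∧ y) = v(x ∨ y) - v(y), read in its two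
   directions. *)
- move=> x y; split.
  + apply: gsim_gsub_cut_limit (mul x) (mul _) (mul _) (mul y) _ _ => [t|].
      by have := v_mod t x y; lra.
    exact/mu_homo/leUr.
  + apply: gsim_gsub_cut_limit (mul _) (mul y) (mul x) (mul _) _ _ => [t|].
      by have := v_mod t x y; lra.
    exact/mu_homo/leIl.
Qed.

End Ultralimits.

(** * The two Stone pairings compared *)

Section StonePairings.
Context (R : realType) (sigma : signature).
Implicit Types (A : fin_structure sigma) (x : FO sigma).

Lemma continuous_gamma_sharp d (D : tbDistrLatticeType d) :
  continuous (@gamma_sharp R d D).
Proof.
move=> mu; apply: (cvg_set_val_eval (fmap_filter _ (nbhs_filter mu))) => x.
apply: (@continuous_comp _ _ _ (fun nu : measureG R D => set_val nu x) (@gamma R)).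
  exact: set_val_eval_continuous.
exact: continuous_gamma.
Qed.

(** One rational underlies both pairings: its image in [R] is the classical value, its symbol q° the
    [Gamma]-valued one. *)
Definition pairing (A : fin_structure sigma) (x : FO sigma) : rat :=
  freq rat A (level x) x.

Lemma pairing01 A x : 0 <= pairing A x <= 1.
Proof. by rewrite freq_ge0 freq_le1. Qed.

Lemma ratr_pairing A x : ratr (pairing A x) = stoneI_fun R A x.
Proof.
by rewrite (stoneI_funE _ _ (FOn_level x)) /pairing /freq fmorph_div !rmorph_nat.
Qed.

Lemma stoneG_pairing A x : set_val (stoneG R A) x = circ (pairing A x).
Proof. exact: (stoneG_funE R A (FOn_level x)). Qed.

Lemma gamma_sharp_stoneG A : gamma_sharp (stoneG R A) = stoneI R A.
Proof.
apply/val_inj/funext => x /=.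
by rewrite (stoneG_pairing A x) gamma_circ ?pairing01 // ratr_pairing.
Qed.

End StonePairings.

Theorem theorem5p7 (R : realType) (sigma : signature) :
  gamma_sharp @` closure (range (@stoneG R sigma)) =
  closure (range (@stoneI R sigma)).
Proof.
apply/seteqP; split=> [_ [mu clmu <-] B Bmu|m clm].
  have [_ [[A _ <-] BA]] := clmu _ (continuous_gamma_sharp Bmu).
  by exists (stoneI R A); split; [exists A|rewrite -gamma_sharp_stoneG].
(* The neighbourhoods of [m] are pulled back to finite structures; the resulting filter is proper
   because [m] lies in the closure. *)
pose F : set_system (fin_structure sigma) :=
  filter_from (nbhs m) (fun B => @stoneI R sigma @^-1` B).
have FF : ProperFilter F.
  apply: filter_from_proper.
    apply: filter_from_filter; first by exists setT; exact: filterT.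
    by move=> B C Bm Cm; exists (B `&` C) => //; exact: filterI.
  by move=> B /clm[_ [[A _ <-] BA]]; exists A.
have [U [UU FU]] := ultraFilterLemma FF.
have stoneIU : @stoneI R sigma @ U --> m by move=> B Bm; apply: FU; exists B.
have /choice[nu nuE] (x : FO sigma) :
    exists y : Gamma R, is_cut_limit U (fun A => pairing A x) y.
  by apply: cut_limit_exists => A; exact: pairing01.
have numeas : is_measureG nu.
  apply: (measureG_cut_limit (U := U) (v := @pairing sigma)) => // A.
  have := stoneI_measure R A; congr is_measureI; apply/funext => x.
  by rewrite ratr_pairing.
pose mu : measureG R (FO sigma) :=
  exist _ (nu : {ptws FO sigma -> Gamma R}) (mem_set numeas).
have stoneGU : @stoneG R sigma @ U --> mu.
  apply: cvg_set_val_eval => x.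
  have := cvg_circ_cut_limit (fun A => pairing01 A x) (nuE x).
  suff -> : (fun A => circ (pairing A x)) = (fun A => set_val (stoneG R A) x).
    exact.
  by apply/funext => A; rewrite (stoneG_pairing R A x).
exists mu.
  (* Members of [U] are nonempty, so every neighbourhood of [mu] contains some [stoneG A]. *)
  by move=> B /stoneGU /(@filter_ex _ U)[A BA]; exists (stoneG R A); split=> //; exists A.
apply/val_inj/funext => x.
(* Along [U] the classical pairings tend both to [gamma (nu x)] and to the value of [m] at [x];
   limits in [R] are unique. *)
have h1 : (fun A => stoneI_fun R A x) @ U --> gamma (nu x).
  have -> : (fun A => stoneI_fun R A x) = @gamma R \o (fun A => circ (pairing A x)).
    by apply/funext => A /=; rewrite gamma_circ ?pairing01 // ratr_pairing.
  apply: (@cvg_comp _ _ _ _ _ U (nbhs (nu x))); last exact: continuous_gamma.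
  exact: cvg_circ_cut_limit (fun A => pairing01 A x) (nuE x).
have h2 : (fun A => stoneI_fun R A x) @ U --> set_val m x.
  exact: (cvg_comp (@stoneI R sigma) (fun f : measureI R (FO sigma) => set_val f x)
    stoneIU (@set_val_eval_continuous _ _ _ x m)).
exact: cvg_unique h1 h2.
Qed.
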